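(* Let $\phi = \frac{1+\sqrt5}{2}$, $a(j) = \lfloor j\phi\rfloor$, $c(j) = a(j)+2j-1$, and let $S = \{c(j)-1 : j \ge 1\}\cup\{c(j)+1 : j \ge 1\}$, with $s(k)$ the $k$-th smallest element of $S$. Then for every positive integer $k$, $\{s(k)\phi\} = \frac{\sqrt5}{2\phi}\{k\phi\} + b$ for some $b$ (depending on $\{k\phi\}$), where $b \in \{0, \frac{1-\sqrt5}{4}, \frac{5-\sqrt5}{4}\}$ if $k$ is even, and $b \in \{-\frac12, \frac12, \frac{3-\sqrt5}{4}, 1-\frac{\sqrt5}{2}, 2-\frac{\sqrt5}{2}\}$ if $k$ is odd.
   Context: $\{x\} = x - \lfloor x\rfloor$ denotes the fractional part. *)

(* Defs.v *)
From HB Require Import structures.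
From mathcomp Require Import all_boot all_order all_algebra.
From mathcomp Require Import finmap.
From mathcomp Require Import all_classical all_reals.
From mathcomp Require Import zify lra.

Set Implicit Arguments.
Unset Strict Implicit.
Unset Printing Implicit Defensive.

Import Order.TTheory GRing.Theory Num.Theory.
Local Open Scope classical_set_scope.
Local Open Scope card_scope.
Local Open Scope ring_scope.

Definition frac_part (R : realType) (x : R) : R := x - (Num.floor x)%:~R.

Definition phi (R : realType) : R := (1 + Num.sqrt 5) / 2.
Arguments phi : clear implicits.

Definition a_seq (R : realType) (j : nat) : int := Num.floor (j%:R * phi R).
Arguments a_seq : clear implicits.

Definition c_seq (R : realType) (j : nat) : int := a_seq R j + 2 * j%:Z - 1.
Arguments c_seq : clear implicits.

Definition S_set (R : realType) : set int :=
  [set c_seq R j - 1 | j in [set j : nat | (1 <= j)%N]] `|`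
  [set c_seq R j + 1 | j in [set j : nat | (1 <= j)%N]].
Arguments S_set : clear implicits.

(* Ranks are 1-based: the minimum of A has rank 1. *)
Definition kth_smallest (A : set int) (k : nat) (x : int) : Prop :=
  A x /\ [set y | A y /\ y <= x] #= `I_k.

(* The default value 0 of [xget] is never used for k >= 1: by [s_seqP] and
   [kth_smallest_uniq], [s_seq R k] is then the unique integer x such that
   [kth_smallest (S_set R) k x]. *)
Definition s_seq (R : realType) (k : nat) : int :=
  xget 0 (kth_smallest (S_set R) k).
Arguments s_seq : clear implicits.

Lemma kth_smallest_uniq (A : set int) (k : nat) (x y : int) :
  kth_smallest A k x -> kth_smallest A k y -> x = y.
Proof.
wlog lexy : x y / x <= y => [H Hx Hy|].
  by case: (leP x y) => [|/ltW] le; [apply: H|apply/esym/H].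
move=> [Ax cx] [Ay cy]; move: lexy; rewrite le_eqVlt => /orP[/eqP//|ltxy].
have fx : finite_set [set z | A z /\ z <= x] by apply/finite_setP; exists k.
have fy : finite_set [set z | A z /\ z <= y] by apply/finite_setP; exists k.
have : #|` fset_set [set z | A z /\ z <= x]| = k.
  by apply/card_eq_fsetP; rewrite fset_setK.
have : #|` fset_set [set z | A z /\ z <= y]| = k.
  by apply/card_eq_fsetP; rewrite fset_setK.
move=> ky kx.
have /eqP E : fset_set [set z | A z /\ z <= x] == fset_set [set z | A z /\ z <= y].
  rewrite eqEfcard ky kx leqnn andbT.
  apply/fsubsetP => z; rewrite !in_fset_set// !inE => -[Az zx]; split => //.
  exact: le_trans (ltW ltxy).
have : y \in fset_set [set z | A z /\ z <= y] by rewrite in_fset_set// inE.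
by rewrite -E in_fset_set// inE => -[_]; rewrite leNgt ltxy.
Qed.

Lemma int_set_min (A : set int) (m : int) :
  (exists2 x, A x & m <= x) ->
  exists x, [/\ A x, m <= x & forall y, A y -> m <= y -> x <= y].
Proof.
move=> [x0 Ax0 mx0].
have ex : exists n : nat, `[< A (m + n%:Z) >].
  by exists `|x0 - m|%N; apply/asboolP; rewrite gez0_abs ?subr_ge0// subrKC.
case: (ex_minnP ex) => n /asboolP An nmin; exists (m + n%:Z); split => //.
  by rewrite lerDl.
move=> y Ay my; have /nmin : `[< A (m + `|(y - m)%R|%N%:Z) >].
  by apply/asboolP; rewrite gez0_abs ?subr_ge0// subrKC.
lia.
Qed.

Lemma kth_smallest_ex (A : set int) (m : int) :
  (forall x, A x -> m <= x) -> (forall n, exists2 x, A x & n <= x) ->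
  forall k, (0 < k)%N -> exists x, kth_smallest A k x.
Proof.
move=> lb ub; case=> // k _; elim: k => [|k [x [Ax cx]]].
  have [x [Ax _ xmin]] := int_set_min (ub m); exists x; split => //=.
  have -> : [set y | A y /\ y <= x] = [set x].
    apply/seteqP; split => y /= => [[Ay yx]|-> //].
    by apply/eqP; rewrite eq_le yx xmin// lb.
  exact: card_set1.
have [y [Ay xy ymin]] := int_set_min (ub (x + 1)); exists y; split => //=.
have fx : finite_set [set z | A z /\ z <= x] by apply/finite_setP; exists k.+1.
have yx : y \notin fset_set [set z | A z /\ z <= x].
  by rewrite in_fset_set//; apply/negP; rewrite inE => -[_]; lia.
have -> : [set z | A z /\ z <= y] =
    [set` (y |` fset_set [set z | A z /\ z <= x])%fset].
  apply/seteqP; split => z /=; rewrite in_fset1U in_fset_set//.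
    move=> [Az zy]; have [->//|zNy] /= := eqVneq z y.
    by rewrite inE; split => //; move: (ymin z Az); lia.
  case/orP => [/eqP ->//|]; rewrite inE => -[Az zx]; split => //; lia.
apply/card_eq_fsetP; rewrite cardfsU1 yx add1n; congr _.+1.
by apply/card_eq_fsetP; rewrite fset_setK.
Qed.

Lemma a_seq_ge (R : realType) (j : nat) : j%:Z <= a_seq R j.
Proof.
rewrite /a_seq floor_ge_int -[X in X <= _]mulr1 ler_wpM2l//.
have s5 : (1 : R) <= Num.sqrt 5 by rewrite -{1}sqrtr1 ler_wsqrtr// ler1n.
by rewrite /phi ler_pdivlMr// mul1r; lra.
Qed.

Lemma s_seqP (R : realType) (k : nat) :
  (0 < k)%N -> kth_smallest (S_set R) k (s_seq R k).
Proof.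
move=> k0; apply: xgetPex; apply: (@kth_smallest_ex _ 0) => //.
  by move=> x [] [j /= j1 <-]; move: (a_seq_ge R j); rewrite /c_seq; lia.
move=> n; exists (c_seq R `|n|%N.+1 + 1); first by right; exists `|n|%N.+1.
by move: (a_seq_ge R `|n|%N.+1); rewrite /c_seq; lia.
Qed.

(* Main.v *)
Require Import Defs.
From mathcomp Require Import all_boot all_order all_algebra.
From mathcomp Require Import all_classical all_reals.
From mathcomp Require Import zify ring lra.

Import Order.TTheory GRing.Theory Num.Theory.
Local Open Scope ring_scope.

(** Consecutive terms of [c] differ by at least 3, so [s(2j-1) = c(j) - 1] and
    [s(2j) = c(j) + 1]. Since [phi^2 = phi + 1], both [{s(k) phi}] and [{k phi}]
    are affine in [t = {j phi}] modulo 1, the slopes [3 - phi] and [2] being in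
    the ratio [alpha = sqrt 5 / (2 phi)]. Hence [b = alpha e - f + const] with
    integers [e], [f]; the range of [t] bounds [e], and
    [-alpha < b < 1] then leaves only the listed values.
    That [b] depends on [{k phi}] alone is the irrationality of [phi]. *)

(** An increasing [g] embeds the order, so the elements up to [g k] are the images of the indices
    [0..k]; index 0 has rank 1. *)
Lemma kth_smallest_range {g : nat -> int} (k : nat) :
  (forall i, g i < g i.+1) -> kth_smallest (range g) k.+1 (g k).
Proof.
move=> /Order.NatMonotonyTheory.incnP gmono.
have gle : {mono g : m n / (m <= n)%N >-> m <= n} := gmono.
split; first by exists k.
have -> : ([set y | range g y /\ y <= g k] = g @` `I_k.+1)%classic.
  apply/seteqP; split => y /=.
    by move=> [[i _ <-]]; rewrite gle => ik; exists i.
  by move=> [i ik <-]; split; [exists i|rewrite gle].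
apply: inj_card_eq => i j _ _ gij.
by apply/eqP; rewrite eqn_leq -!gle gij lexx.
Qed.

Section GoldenRatio.
Variable R : realType.
Local Notation phi := (phi R).

Lemma sqr_sqrt5 : Num.sqrt 5 ^+ 2 = 5 :> R.
Proof. by rewrite sqr_sqrtr ?ler0n. Qed.

(** The numeric input with which [lra] later confines the integers [M] and [N]. *)
Lemma sqrt5_bounds : 2236 / 1000 < Num.sqrt (5 : R) < 2237 / 1000.
Proof.
have s0 : 0 <= Num.sqrt 5 :> R by apply: sqrtr_ge0.
by have s2 := sqr_sqrt5; apply/andP; split; nra.
Qed.

Lemma slopeE : Num.sqrt 5 / (2 * phi) = (5 - Num.sqrt 5) / 4.
Proof.
have [s1 s2] := andP sqrt5_bounds; have s3 := sqr_sqrt5.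
apply/eqP; rewrite /Defs.phi eqr_div; [|lra|lra].
by apply/eqP; lra.
Qed.

(** Since [2 phi - 1 = sqrt 5], the relation squares to [(2m - n)^2 = 5 n^2]; for [n] nonzero the
    5-adic valuation is even on the left and odd on the right. *)
Lemma phi_irrational (m n : int) : n%:~R * phi = m%:~R -> n = 0.
Proof.
move=> nm; have s2 := sqr_sqrt5.
have /intr_inj E : ((2 * m - n) ^+ 2)%:~R = (5 * n ^+ 2)%:~R :> R.
  rewrite !(rmorphXn, rmorphM, rmorphB) /= -nm /Defs.phi.
  rewrite (_ : _ - _ = n%:~R * Num.sqrt 5); last by field.
  by rewrite exprMn s2 mulrC.
have {}E : (`|(2 * m - n)%R| ^ 2 = 5 * `|n| ^ 2)%N.
  by rewrite -!abszX E abszM.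
case: (posnP `|n|%N) => [/eqP|n0]; first by rewrite absz_eq0 => /eqP.
have := congr1 (odd \o logn 5) E.
by rewrite /= lognM ?expn_gt0 ?n0// !lognX (@logn_prime 5 5)// oddD !oddM.
Qed.

Lemma frac_part_phi_inj :
  injective (fun k : nat => frac_part (k%:R * phi)).
Proof.
move=> k l; rewrite /frac_part => kl.
suff : k%:Z - l%:Z = 0 by lia.
apply: (@phi_irrational (Num.floor (k%:R * phi) - Num.floor (l%:R * phi))).
by rewrite !rmorphB /= -!pmulrn; lra.
Qed.

Lemma frac_part_itv (x : R) : 0 <= frac_part x < 1.
Proof. by have := floor_itv x; rewrite intrD /frac_part; lra. Qed.

Lemma a_seq_lt (j : nat) : a_seq R j < a_seq R j.+1.
Proof.
rewrite -lezD1 /a_seq floor_ge_int intrD -natr1 mulrDl mul1r.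
have /andP[] := floor_itv (j%:R * phi).
have := sqrt5_bounds; rewrite /Defs.phi; lra.
Qed.

Lemma s_seqE (k : nat) :
  s_seq R k.+1 = c_seq R (k./2).+1 + (if odd k then 1 else -1).
Proof.
pose g i := c_seq R (i./2).+1 + (if odd i then 1 else -1).
(* Within a pair the gap is 2; between pairs it is [c(j+1) - c(j) - 2], at least 1. *)
have glt i : g i < g i.+1.
  rewrite /g /c_seq /= uphalf_half; case: (odd i) => /=; last by rewrite add0n; lia.
  by rewrite add1n; have := a_seq_lt (i./2).+1; lia.
have Sg : S_set R = range g.
  apply/seteqP; split => x /=.
    move=> [] [[//|j] _ <-].
      by exists j.*2 => //; rewrite /g doubleK odd_double.
    by exists j.*2.+1 => //; rewrite /g /= uphalf_double odd_double.
  by move=> [i _ <-]; rewrite /g; case: (odd i); [right|left]; exists (i./2).+1.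
apply: kth_smallest_uniq (s_seqP R _) _ => //.
by rewrite Sg; apply: (kth_smallest_range k glt).
Qed.

(** With [a = j phi - t] and [phi^2 = phi + 1], the product is [(3 - phi) t + j + 3a]. *)
Lemma golden_affine (j : nat) :
  let t := frac_part (j%:R * phi) in
  exists n : int,
    (a_seq R j + 2 * j%:Z)%:~R * phi = (5 - Num.sqrt 5) / 2 * t + n%:~R.
Proof.
move=> t; exists (j%:Z + 3 * a_seq R j).
have s2 := sqr_sqrt5.
have tE : j%:R * phi = t + (a_seq R j)%:~R by rewrite /t /frac_part subrK.
move: tE; rewrite !(rmorphD, rmorphM) /= -!pmulrn.
set a := (a_seq R j)%:~R; move: t a => t a; rewrite /Defs.phi => tE.
have -> : t = j%:R * ((1 + Num.sqrt 5) / 2) - a by rewrite tE addrK.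
by field: s2.
Qed.

Lemma int_between {m lo hi : int} :
  lo%:~R < m%:~R :> R -> m%:~R < hi%:~R :> R -> lo < m < hi.
Proof. by rewrite !ltr_int => -> ->. Qed.

(* [d = 0] for the even ranks [2j], and [d = phi] for the odd ranks [2j-1]. *)
Lemma frac_part_gap {x y t d : R} {n p : int} (alpha := (5 - Num.sqrt 5) / 4) :
  0 <= t < 1 -> x = 2 * t + n%:~R - d -> y = 2 * alpha * t + p%:~R - 2 * d ->
  exists M N : int,
    let b := M%:~R - alpha * N%:~R - (2 - alpha) * d in
    [/\ frac_part y - alpha * frac_part x = b,
        d - 2 < N%:~R < d + 1 & - alpha < b < 1].
Proof.
move=> /andP[t0 t1] xE yE; have [s1 s2] := andP sqrt5_bounds.
have [u0 u1] := andP (frac_part_itv x); have [v0 v1] := andP (frac_part_itv y).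
pose N := n - Num.floor x; pose M := p - Num.floor y.
have uE : frac_part x = 2 * t + N%:~R - d.
  by rewrite /frac_part {1}xE rmorphB /=; ring.
have vE : frac_part y = 2 * alpha * t + M%:~R - 2 * d.
  by rewrite /frac_part {1}yE rmorphB /=; ring.
have alpha_gt0 : 0 < alpha by rewrite /alpha; lra.
have au0 : 0 <= alpha * frac_part x by rewrite mulr_ge0// ltW.
have au1 : alpha * frac_part x < alpha by rewrite gtr_pMr.
(* The slopes in [t] are [2 alpha] and [2], so [t] cancels. *)
have bE : frac_part y - alpha * frac_part x
    = M%:~R - alpha * N%:~R - (2 - alpha) * d by rewrite uE vE; ring.
by exists M, N; rewrite /= -bE; split=> //; apply/andP; split; lra.
Qed.

(** Rank [2j], where [s(2j) = c(j) + 1 = a(j) + 2j]. *)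
Lemma even_values (j : nat) :
  frac_part ((a_seq R j + 2 * j%:Z)%:~R * phi)
    - (5 - Num.sqrt 5) / 4 * frac_part ((j.*2)%:R * phi)
  \in [:: 0; (1 - Num.sqrt 5) / 4; (5 - Num.sqrt 5) / 4].
Proof.
have [s1 s2] := andP sqrt5_bounds; have [n yE] := golden_affine j.
have xE : (j.*2)%:R * phi
    = 2 * frac_part (j%:R * phi) + (2 * a_seq R j)%:~R - 0.
  by rewrite /frac_part -mul2n rmorphM /= natrM; ring.
have {}yE : (a_seq R j + 2 * j%:Z)%:~R * phi
    = 2 * ((5 - Num.sqrt 5) / 4) * frac_part (j%:R * phi) + n%:~R - 2 * 0.
  by rewrite yE; field.
have [M [N [-> /andP[N0 N1]]]] := frac_part_gap (frac_part_itv _) xE yE.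
have /orP[/eqP->|/eqP->] : (N == 0) || (N == -1).
- have /andP[] : -2 < N < 1 by apply: int_between; lra.
  lia.
- move=> /andP[b0 b1]; have -> : M = 0.
    have /andP[] : -1 < M < 1 by apply: int_between; lra.
    lia.
  by rewrite !inE; apply/or3P/Or31; apply/eqP; lra.
(* Here [b = M + alpha] with [alpha] about 0.69. *)
- move=> /andP[b0 b1]; have /orP[/eqP->|/eqP->] : (M == 0) || (M == -1).
    have /andP[] : -2 < M < 1 by apply: int_between; lra.
    lia.
  + by rewrite !inE; apply/or3P/Or33; apply/eqP; lra.
  + by rewrite !inE; apply/or3P/Or32; apply/eqP; lra.
Qed.

(** Rank [2j+1], where [s(2j+1) = c(j+1) - 1 = a(j+1) + 2j]. *)
Lemma odd_values (j : nat) :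
  frac_part ((a_seq R j.+1 + 2 * j%:Z)%:~R * phi)
    - (5 - Num.sqrt 5) / 4 * frac_part ((j.*2.+1)%:R * phi)
  \in [:: - (1 / 2); 1 / 2; (3 - Num.sqrt 5) / 4;
          1 - Num.sqrt 5 / 2; 2 - Num.sqrt 5 / 2].
Proof.
have [s1 s2] := andP sqrt5_bounds; have [n yE] := golden_affine j.+1.
have xE : (j.*2.+1)%:R * phi
    = 2 * frac_part (j.+1%:R * phi) + (2 * a_seq R j.+1)%:~R - phi.
  rewrite /frac_part -mul2n -[in LHS]natr1 natrM -natr1 rmorphM /=.
  by rewrite /a_seq -natr1; ring.
have {}yE : (a_seq R j.+1 + 2 * j%:Z)%:~R * phi
    = 2 * ((5 - Num.sqrt 5) / 4) * frac_part (j.+1%:R * phi) + n%:~R - 2 * phi.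
  rewrite (_ : _ + _ = a_seq R j.+1 + 2 * j.+1%:Z - 2); last by lia.
  by rewrite rmorphB /= mulrBl yE; field.
have [M [N [-> ]]] := frac_part_gap (frac_part_itv _) xE yE.
have -> : (2 - (5 - Num.sqrt 5) / 4) * phi = 1 + Num.sqrt 5 / 2.
  by have := sqr_sqrt5; rewrite /Defs.phi; lra.
rewrite /Defs.phi => /andP[N0 N1].
(* [N] lies strictly between [phi - 2] and [phi + 1], about -0.38 and 2.62. *)
have /or3P[] : [|| N == 0, N == 1 | N == 2].
  have /andP[] : -1 < N < 3 by apply: int_between; lra.
  lia.
- move=> /eqP-> /andP[b0 b1].
  have /orP[/eqP->|/eqP->] : (M == 2) || (M == 3).
    have /andP[] : 1 < M < 4 by apply: int_between; lra.
    lia.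
  + by rewrite !inE; apply/or4P/Or44/orP; left; apply/eqP; lra.
  + by rewrite !inE; apply/or4P/Or44/orP; right; apply/eqP; lra.
- move=> /eqP-> /andP[b0 b1]; have -> : M = 3.
    have /andP[] : 2 < M < 4 by apply: int_between; lra.
    lia.
  by rewrite !inE; apply/or4P/Or43; apply/eqP; lra.
(* For [N = 2] the multiples of [sqrt 5] cancel and [b = M - 7/2]. *)
- move=> /eqP-> /andP[b0 b1].
  have /orP[/eqP->|/eqP->] : (M == 3) || (M == 4).
    have /andP[] : 2 < M < 5 by apply: int_between; lra.
    lia.
  + by rewrite !inE; apply/or4P/Or41; apply/eqP; lra.
  + by rewrite !inE; apply/or4P/Or42; apply/eqP; lra.
Qed.

End GoldenRatio.

Theorem theorem4p6 (R : realType) :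
  exists b : R -> R, forall k : nat, (0 < k)%N ->
    frac_part ((s_seq R k)%:~R * phi R) =
      Num.sqrt 5 / (2 * phi R) * frac_part (k%:R * phi R) + b (frac_part (k%:R * phi R))
    /\ (~~ odd k ->
          b (frac_part (k%:R * phi R)) \in
            [:: 0; (1 - Num.sqrt 5) / 4; (5 - Num.sqrt 5) / 4])
    /\ (odd k ->
          b (frac_part (k%:R * phi R)) \in
            [:: - (1 / 2); 1 / 2; (3 - Num.sqrt 5) / 4;
                1 - Num.sqrt 5 / 2; 2 - Num.sqrt 5 / 2]).
Proof.
(* [rank] inverts the injective map sending [k] to [{k phi}]; the default 0 only affects reals
   outside its image. *)
pose rank (x : R) : nat := xget 0%N [set k : nat | frac_part (k%:R * phi R) = x]%classic.
exists (fun x => frac_part ((s_seq R (rank x))%:~R * phi R)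
                 - Num.sqrt 5 / (2 * phi R) * x).
case=> [//|k _].
have -> : rank (frac_part (k.+1%:R * phi R)) = k.+1.
  by apply: xget_unique => // l /frac_part_phi_inj.
split; first by rewrite addrC subrK.
rewrite slopeE s_seqE /c_seq /=.
(* The rank is [k.+1], so odd [k] is the even-rank case. *)
have := odd_double_half k; case: (odd k) => /= kE; split=> // _.
- have {1}-> : k.+1 = (k./2).+1.*2 by rewrite -{1}kE doubleS.
  by rewrite subrK; apply: even_values.
- have {1}-> : k.+1 = (k./2).*2.+1 by rewrite -{1}kE.
  rewrite (_ : _ + _ = a_seq R (k./2).+1 + 2 * (k./2)%:Z); last by lia.
  exact: odd_values.
Qed.
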